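(* Let $F$ be a field and let $X\subseteq\operatorname{Zar}(F)$ be such that $A(X)$ is a proper subring of $F$ with quotient field $F$. If $\lim(X)$ is finite and all but finitely many valuation rings in $X$ have rank one, then the ring $A(X)$ is one of the following types of rings: (a) a domain of finite real character; (b) a Prüfer domain with nonzero Jacobson radical such that all but finitely many maximal ideals have height one and are the radical of a finitely generated ideal; or (c) an intersection $A(X)=B\cap C$, where $B$ is a ring as in (a) and $C$ is a ring as in (b), both with quotient field $F$.
   Context: A valuation ring of the field $F$ is a subring $V$ of $F$ such that for each $0\ne t\in F$, $t\in V$ or $t^{-1}\in V$ (so $F$ itself is one); $\operatorname{Zar}(F)$ is the set of all valuation rings of $F$. The rank of a valuation ring is its Krull dimension. For nonempty $X\subseteq\operatorname{Zar}(F)$ put $A(X)=\bigcap_{V\in X}V$. The patch topology on $\operatorname{Zar}(F)$ is the topology having as a basis the sets $\{V: x_1,\dots,x_n\in V,\ y_1\notin V,\dots,y_m\notin V\}$ with $x_i,y_j\in F$, $n,m\ge 0$ (it is compact Hausdorff). $\lim(X)$ is the set of limit points of $X$ in $\operatorname{Zar}(F)$ in the patch topology, i.e. those $U\in\operatorname{Zar}(F)$ such that every patch open neighborhood of $U$ contains a point of $X$ different from $U$. A collection $X\subseteq\operatorname{Zar}(F)$ has finite character if each nonzero $x\in F$ is a unit in all but finitely many valuation rings of $X$. A domain $A$ with quotient field $F$ has finite real character if there is a finite character collection $X$ of rank one valuation rings in $\operatorname{Zar}(F)$ such that $A=A(X)$. A Prüfer domain is a domain whose localization at each maximal ideal is a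 valuation domain. *)

(* Defs.v *)
From HB Require Import structures.
From mathcomp Require Import all_boot all_order all_algebra.
From mathcomp Require Import all_classical topology.

Set Implicit Arguments.
Unset Strict Implicit.
Unset Printing Implicit Defensive.

Import GRing.Theory.

Local Open Scope classical_set_scope.
Local Open Scope ring_scope.

(* Subrings of a field F, and ideals of such subrings, are subsets of F; a    *)
(* subring contains the 1 of F. All ideal-theoretic notions below take the    *)
(* ambient subring A as their first explicit argument.                        *)

Section Domains.
Variable F : fieldType.
Implicit Types A V I P M S : set F.

Definition subring A : Prop := subring_closed (mem A).

(* The quotient field of A, as a subset of F. *)
Definition fractions A : set F := [set a / b | a in A & b in A `\ 0].

Definition ideal A I : Prop :=
  [/\ I `<=` A, I 0, forall x y, I x -> I y -> I (x + y)
    & forall a x, A a -> I x -> I (a * x)].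

Definition prime_ideal A P : Prop :=
  [/\ ideal A P, ~ P 1
    & forall a b, A a -> A b -> P (a * b) -> P a \/ P b].

Definition maximal_ideal A M : Prop :=
  [/\ ideal A M, M `<` A & forall I, ideal A I -> M `<=` I -> I `<` A -> I = M].

Definition jacobson A : set F :=
  A `&` \bigcap_(M in [set M | maximal_ideal A M]) M.

Definition radical A I : set F := [set x | A x /\ exists n, I (x ^+ n.+1)].

Definition fg_ideal A I : Prop :=
  exists S, [/\ finite_set S, S `<=` A & I = smallest (ideal A) S].

(* A strictly increasing chain c 0 < ... < c n, of length n; the values of c  *)
(* beyond n are irrelevant.                                                   *)
Definition prime_chain A (n : nat) (c : nat -> set F) : Prop :=
  (forall i, (i <= n)%N -> prime_ideal A (c i)) /\
  (forall i, (i < n)%N -> c i `<` c i.+1).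

Definition krull_dim A (d : nat) : Prop :=
  (exists c, prime_chain A d c) /\
  (forall n c, prime_chain A n c -> (n <= d)%N).

Definition ideal_height A M (d : nat) : Prop :=
  (exists c, prime_chain A d c /\ c d = M) /\
  (forall n c, prime_chain A n c -> c n = M -> (n <= d)%N).

Definition localization A M : set F := [set a / s | a in A & s in A `\` M].

(* V is a valuation ring of its own quotient field. *)
Definition valuation_domain V : Prop :=
  subring V /\ forall t, fractions V t -> t != 0 -> V t \/ V t^-1.

Definition prufer_domain A : Prop :=
  subring A /\ forall M, maximal_ideal A M -> valuation_domain (localization A M).

Definition valuation_ring V : Prop :=
  subring V /\ forall t, t != 0 -> V t \/ V t^-1.

End Domains.

Record Zar (F : fieldType) := MkZar {
  zar_set : set F;
  zar_valuation : valuation_ring zar_set }.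

HB.instance Definition _ (F : fieldType) := gen_eqMixin (Zar F).
HB.instance Definition _ (F : fieldType) := gen_choiceMixin (Zar F).

Section PatchTopology.
Variable F : fieldType.

Definition patch_index : set (set F * set F) :=
  [set xy | finite_set xy.1 /\ finite_set xy.2].

Definition patch_basic (xy : set F * set F) : set (Zar F) :=
  [set V | xy.1 `<=` zar_set V /\ xy.2 `<=` ~` zar_set V].

Lemma patch_basic_cover : \bigcup_(i in patch_index) patch_basic i = setT.
Proof.
apply/seteqP; split=> // V _; exists (set0, set0); split=> /=;
  by [exact: finite_set0 | exact: sub0set].
Qed.

Lemma patch_basic_join i j V : patch_index i -> patch_index j ->
  patch_basic i V -> patch_basic j V ->
  exists k, [/\ patch_index k, patch_basic k V
              & patch_basic k `<=` patch_basic i `&` patch_basic j].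
Proof.
move=> [fi1 fi2] [fj1 fj2] [i1 i2] [j1 j2].
exists (i.1 `|` j.1, i.2 `|` j.2); split=> /=.
- by split; rewrite finite_setU.
- by split; rewrite subUset.
- by move=> W [/= ]; rewrite !subUset => -[? ?] [? ?].
Qed.

HB.instance Definition _ := @isBaseTopological.Build (Zar F)
  (set F * set F)%type patch_index patch_basic patch_basic_cover
  patch_basic_join.

End PatchTopology.

Section Collections.
Variable F : fieldType.
Implicit Types (V : Zar F) (X Y : set (Zar F)) (A : set F).

(* A(X), meaningful for nonempty X; it is the whole of F for empty X. *)
Definition zar_inter X : set F := \bigcap_(V in X) zar_set V.

Definition rank V (r : nat) : Prop := krull_dim (zar_set V) r.

Definition finite_character X : Prop :=
  forall x : F, x != 0 ->
    finite_set (X `&` [set V | ~ (zar_set V x /\ zar_set V x^-1)]).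

Definition finite_real_character A : Prop :=
  fractions A = setT /\
  exists Y, [/\ Y !=set0, finite_character Y, forall V, Y V -> rank V 1%N
              & A = zar_inter Y].

Definition prufer_type A : Prop :=
  [/\ prufer_domain A,
      exists2 x, jacobson A x & x != 0
    & finite_set [set M | maximal_ideal A M /\
        ~ (ideal_height A M 1%N /\
           exists2 I, fg_ideal A I & M = radical A I)]].

End Collections.

(* Main.v *)
Require Import Defs.
From mathcomp Require Import all_boot all_order all_algebra.
From mathcomp Require Import all_classical topology.
From mathcomp Require Import ring.

(** Fix a nonzero x in A(X) lying in the maximal ideal of each member of lim X
    and of each member of X not of rank one, F itself excepted.  Such an x
    exists since only finitely many valuation rings are concerned and each has
    a nonzero center on A(X), the quotient field of A(X) being F
    ([common_center]).  Whether x is a unit is a patch clopen condition, and it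
    splits X.

    Where x is a unit, the members of X other than F have rank one.  They form
    a collection XB that can only accumulate at F.  By compactness, for y <> 0
    the members of XB where y is not a unit form a set without limit points,
    hence a finite one ([finite_character_trivial_limit]).  This gives the
    ring B.

    The members of X and lim X where x is a nonunit form a collection Y.
    Outside a finite set E they are of rank one and incomparable to the other
    members, and any infinite subset of Y accumulates at a point of E.  The
    claim is that C = A(Y) is as in (b); if XB or Y is empty, the other one
    gives A(X).  Put geom s u = 1 + u + ... + u^(s-1).

    - Given finitely many valuation rings, some s >= 2 makes geom s u a unit in
      each of those that contain u (Nagata's device, [geom_unit_finite]); where
      u is not a member, geom s u is a unit times u^(s-1) anyway.
    - Let W be in Y outside E.  If t is not in W, then r = x t^n is not in W
      for n large, W being of rank one.  Each U in E has at most one n for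
      which r is a unit, so n may be chosen so that r is not a unit on E; then
      r is a unit in only finitely many members of Y.  With s as above for
      these, e = 1 / geom s r is in A(Y), vanishes modulo the maximal ideal
      of W, and is 1 modulo that of each V where t vanishes
      ([separating_element]).  Compactness then provides an element which is 1
      at W and 0 at every other member of Y ([isolating_element]).
    - Given u in F, take s for u and the finite set E.  Then geom s u misbehaves
      only at finitely many W in Y outside E; adding to it the sum z of the
      isolating elements of those W repairs it everywhere
      ([nagata_correction]).  Consequently the fractional ideal (1, u) is
      invertible ([invertible_1_u]), and any a, b in A(Y) have a combination
      that is a unit wherever a or b is ([bezout_units]).
    - By compactness again, a maximal ideal of A(Y) cannot contain, for each V
      in Y, a unit of V: so it is the center of some V ([maximal_ideal_center]),
      and localizing at a center gives back V since (1, u) is invertible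
      ([localization_center]).  Thus A(Y) is Pruefer, x is in its Jacobson
      radical, and the centers of the W outside E have height one and are
      radicals of principal ideals, generated by 1 minus an isolating element
      or, should that be 0, by x ([height1_center], [radical_fg_center]). *)

Set Implicit Arguments.
Unset Strict Implicit.
Unset Printing Implicit Defensive.

Import GRing.Theory.

Local Open Scope classical_set_scope.
Local Open Scope ring_scope.

(** * Finite sets *)

Lemma subsingleton_finite (T : eqType) (S : set T) :
  (forall a b, S a -> S b -> a = b) -> finite_set S.
Proof.
move=> Sab; have [[a Sa]|nS] := pselect (S !=set0); last first.
  by rewrite (_ : S = set0) //; apply/seteqP; split=> // a Sa; case: nS;
     exists a.
by apply: sub_finite_set (finite_set1 a) => b Sb /=; exact: Sab.
Qed.

Lemma eventually_finite (T : eqType) (S : set T) (P : T -> nat -> Prop) :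
  finite_set S ->
  (forall U, S U -> exists n0, forall n, (n0 <= n)%N -> P U n) ->
  exists n0, forall n, (n0 <= n)%N -> forall U, S U -> P U n.
Proof.
move=> /finite_seqP[l ->]; elim: l => [|U l IHl] HP; first by exists 0%N.
have [n0 Hn0] := IHl (fun V lV => HP V (mem_behead (s := U :: l) lV)).
have [n1 Hn1] := HP U (mem_head U l).
exists (maxn n0 n1) => n; rewrite geq_max => /andP[n0n n1n] V /=.
by rewrite in_cons => /orP[/eqP ->|lV]; [exact: Hn1|exact: Hn0].
Qed.

Lemma filter_forall_finite (I : eqType) (T : Type) (G : set_system T) (A : set I)
    (P : I -> set T) :
  Filter G -> finite_set A -> (forall a, A a -> G (P a)) ->
  G [set V | forall a, A a -> P a V].
Proof.
move=> FG fA; have [l eA] := (finite_seqP A).1 fA.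
subst A; clear fA.
elim: l => [|a l IHl] GP.
  by apply: filterS filterT => V _ a.
have Ga : G (P a) by apply: GP; rewrite /= mem_head.
have Gl := IHl (fun b lb => GP b (mem_behead (s := a :: l) lb)).
apply: filterS (filterI Ga Gl) => V [Pa Pl] b /=.
by rewrite in_cons => /orP[/eqP ->|]; [exact: Pa|exact: Pl].
Qed.

(** * Valuation rings and their maximal ideals *)

Section ValuationRing.
Variable F : fieldType.
Implicit Types (V W : Zar F) (t u a b : F).

(** The inverse of 0 is 0, a member of V; hence the separate disjunct. A nonzero
    t of V is a nonunit exactly when its inverse is not in V. *)
Definition zar_max V : set F := [set t | t = 0 \/ ~ zar_set V t^-1].

Definition zar_unit V t : Prop := [/\ t != 0, zar_set V t & zar_set V t^-1].

Lemma subringP (A : set F) : subring A <->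
  [/\ A 1, forall a b, A a -> A b -> A (a - b)
    & forall a b, A a -> A b -> A (a * b)].
Proof.
split=> [[A1 AB AM]|[A1 AB AM]].
  split=> [|a b Aa Ab|a b Aa Ab]; first exact: (set_mem A1).
    by apply: (set_mem (AB a b _ _)); exact: mem_set.
  by apply: (set_mem (AM a b _ _)); exact: mem_set.
split=> [|a b /set_mem Aa /set_mem Ab|a b /set_mem Aa /set_mem Ab].
- exact: (mem_set A1).
- exact: (mem_set (AB a b Aa Ab)).
- exact: (mem_set (AM a b Aa Ab)).
Qed.

Lemma zar1 V : zar_set V 1.
Proof. by have [/subringP[]] := zar_valuation V. Qed.

Lemma zarB V a b : zar_set V a -> zar_set V b -> zar_set V (a - b).
Proof. by have [/subringP[_ +]] := zar_valuation V => + _ _; apply. Qed.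

Lemma zarM V a b : zar_set V a -> zar_set V b -> zar_set V (a * b).
Proof. by have [/subringP[_ _ +]] := zar_valuation V => + _; apply. Qed.

Lemma zar0 V : zar_set V 0.
Proof. by rewrite -(subrr 1); apply: zarB; exact: zar1. Qed.

Lemma zarN V a : zar_set V a -> zar_set V (- a).
Proof. by rewrite -sub0r => Va; apply: zarB => //; exact: zar0. Qed.

Lemma zarD V a b : zar_set V a -> zar_set V b -> zar_set V (a + b).
Proof. by move=> Va Vb; rewrite -[b]opprK; apply/zarB/zarN. Qed.

Lemma zarX V a n : zar_set V a -> zar_set V (a ^+ n).
Proof.
move=> Va; elim: n => [|n IHn]; first exact: zar1.
by rewrite exprS; exact: zarM.
Qed.

Lemma zar_notin_neq0 V t : ~ zar_set V t -> t != 0.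
Proof. by apply: contra_notN => /eqP ->; exact: zar0. Qed.

Lemma zar_dichotomy V t : zar_set V t \/ zar_set V t^-1.
Proof.
have [->|t0] := eqVneq t 0; first by left; exact: zar0.
by case: (zar_valuation V) => _; apply.
Qed.

Lemma zar_max_sub V t : zar_max V t -> zar_set V t.
Proof.
case=> [->|nVt]; first exact: zar0.
by case: (zar_dichotomy V t).
Qed.

Lemma zar_max0 V : zar_max V 0. Proof. by left. Qed.

Lemma zar_max1 V : ~ zar_max V 1.
Proof. by case=> [/eqP|]; rewrite ?oner_eq0 // invr1; apply; exact: zar1. Qed.

Lemma zar_max_inv V t : ~ zar_set V t -> zar_max V t^-1.
Proof. by move=> nVt; right; rewrite invrK. Qed.

Lemma zar_unit_neq0 V t : zar_unit V t -> t != 0. Proof. by case. Qed.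

Lemma zar_unit_sub V t : zar_unit V t -> zar_set V t. Proof. by case. Qed.

Lemma zar_unit_inv V t : zar_unit V t -> zar_set V t^-1. Proof. by case. Qed.

Lemma zar_max_unitF V t : zar_max V t -> ~ zar_unit V t.
Proof. by case=> [->|nVt] []; rewrite ?eqxx. Qed.

Lemma zar_unitVmax V t : zar_set V t -> zar_unit V t \/ zar_max V t.
Proof.
move=> Vt; have [->|t0] := eqVneq t 0; first by right; left.
by have [Vt'|] := pselect (zar_set V t^-1); [left|right; right].
Qed.

Lemma zar_maxN_unit V t : zar_set V t -> ~ zar_max V t -> zar_unit V t.
Proof. by move=> /zar_unitVmax[]. Qed.

Lemma zar_unitM V a b : zar_unit V a -> zar_unit V b -> zar_unit V (a * b).
Proof.
by case=> ? ? ? [? ? ?]; split; rewrite ?mulf_neq0 ?invfM //; exact: zarM.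
Qed.

Lemma zar_unitV V a : zar_unit V a -> zar_unit V a^-1.
Proof. by case=> ? ? ?; split; rewrite ?invr_eq0 ?invrK. Qed.

Lemma zar_unit1 V : zar_unit V 1.
Proof. by split; rewrite ?oner_eq0 ?invr1 //; exact: zar1. Qed.

Lemma zar_unitX V a n : zar_unit V a -> zar_unit V (a ^+ n).
Proof.
move=> Va; elim: n => [|n IHn]; first exact: zar_unit1.
by rewrite exprS; exact: zar_unitM.
Qed.

Lemma zar_maxMr V a b : zar_set V a -> zar_max V b -> zar_max V (a * b).
Proof.
move=> Va [->|nVb]; first by rewrite mulr0; left.
have [->|a0] := eqVneq a 0; first by rewrite mul0r; left.
right => Vab; apply: nVb.
have -> : b^-1 = a * (a * b)^-1 by rewrite invfM mulVKf.
exact: zarM.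
Qed.

Lemma zar_maxMl V a b : zar_max V a -> zar_set V b -> zar_max V (a * b).
Proof. by rewrite mulrC => ? ?; exact: zar_maxMr. Qed.

Lemma zar_maxN V a : zar_max V a -> zar_max V (- a).
Proof. by rewrite -mulN1r; apply: zar_maxMr; apply/zarN/zar1. Qed.

Lemma zar_maxX V a n : zar_max V a -> zar_max V (a ^+ n.+1).
Proof.
by move=> Va; rewrite exprS; apply: zar_maxMl => //; apply/zarX/zar_max_sub.
Qed.

(** Of a / b and b / a one is in V, so that the sum is a multiple of a or b. *)
Lemma zar_maxD V a b : zar_max V a -> zar_max V b -> zar_max V (a + b).
Proof.
have [->|a0] := eqVneq a 0; first by rewrite add0r.
have [->|b0] := eqVneq b 0; first by rewrite addr0.
have wlogD c d : c != 0 -> d != 0 -> zar_set V (c / d) -> zar_max V c ->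
    zar_max V d -> zar_max V (c + d).
  move=> c0 d0 Vcd Mc Md.
  have -> : c + d = (c / d + 1) * d by rewrite mulrDl divfK // mul1r.
  by apply: zar_maxMr => //; apply: zarD => //; exact: zar1.
move=> Ma Mb; have [Vab|Vba] := zar_dichotomy V (a / b); first exact: wlogD.
by rewrite addrC; apply: wlogD => //; rewrite -invf_div.
Qed.

Lemma zar_maxB V a b : zar_max V a -> zar_max V b -> zar_max V (a - b).
Proof. by move=> ? ?; apply/zar_maxD/zar_maxN. Qed.

Lemma zar_maxM_prime V a b : zar_set V a -> zar_set V b ->
  zar_max V (a * b) -> zar_max V a \/ zar_max V b.
Proof.
move=> /zar_unitVmax[Ua|]; last by left.
move=> /zar_unitVmax[Ub|]; last by right.
by move/zar_max_unitF; case; exact: zar_unitM.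
Qed.

Lemma zar_maxX_prime V a n : zar_set V a -> zar_max V (a ^+ n) -> zar_max V a.
Proof.
move=> /zar_unitVmax[Ua|//] /zar_max_unitF; case; exact: zar_unitX.
Qed.

Lemma zar_unitDmax V a b : zar_unit V a -> zar_max V b -> zar_unit V (a + b).
Proof.
move=> Ua Mb; apply: zar_maxN_unit => [|Mab].
  by apply: zarD; [exact: zar_unit_sub|exact: zar_max_sub].
by apply: zar_max_unitF Ua; rewrite -[a](addrK b); exact: zar_maxB.
Qed.

Lemma zar_max_unit1 V a : zar_max V (1 - a) -> zar_unit V a.
Proof.
move=> /zar_maxN Ma; rewrite -[a](addrNK 1) addrC.
by apply: zar_unitDmax; [exact: zar_unit1 | rewrite -opprB].
Qed.

Lemma zarXV V t n : zar_set V (t ^+ n.+1) -> zar_set V t.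
Proof.
move=> Vtn; have [//|Vt'] := zar_dichotomy V t.
have [t0|t0] := eqVneq t 0; first by rewrite t0; exact: zar0.
have -> : t = t ^+ n.+1 * t^-1 ^+ n.
  by rewrite exprS -mulrA -exprMn divff ?expr1n ?mulr1.
by apply: zarM => //; exact: zarX.
Qed.

Lemma zar_unitXV V t n : zar_unit V (t ^+ n.+1) -> zar_unit V t.
Proof.
case; rewrite expf_eq0 /= -exprVn => t0 Vt Vt'.
by split=> //; [apply: zarXV Vt | apply: zarXV Vt'].
Qed.

(** Members of Zar(F) are compared as records, whose second component is a
    proof. *)
Lemma zar_inj V W : zar_set V = zar_set W -> V = W.
Proof.
case: V W => V hV [W hW] /= eVW; subst W; congr MkZar; exact: Prop_irrelevance.
Qed.

(** If a is in W but not in W', and b in W' but not in W, then neither a / b nor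
    b / a can be in V. *)
Lemma zar_overring_total V W W' : zar_set V `<=` zar_set W ->
  zar_set V `<=` zar_set W' ->
  zar_set W `<=` zar_set W' \/ zar_set W' `<=` zar_set W.
Proof.
move=> VW VW'; have [|/existsNP[a /not_implyP[Wa nW'a]]] :=
  pselect (zar_set W `<=` zar_set W'); first by left.
right=> b W'b; apply: contrapT => nWb.
have a0 := zar_notin_neq0 nW'a.
have b0 := zar_notin_neq0 nWb.
have [Vab|] := zar_dichotomy V (a / b).
  by apply: nW'a; rewrite -[a](divfK b0); apply: zarM => //; exact: VW'.
rewrite invf_div => Vba.
by apply: nWb; rewrite -[b](divfK a0); apply: zarM => //; exact: VW.
Qed.

(** * Rank one *)

Lemma zar_max_prime V : prime_ideal (zar_set V) (zar_max V).
Proof.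
split; last exact: zar_maxM_prime.
- split; [exact: zar_max_sub|exact: zar_max0|exact: zar_maxD|exact: zar_maxMr].
- exact: zar_max1.
Qed.

Lemma zero_prime_ideal (A : set F) : A 0 -> prime_ideal A [set 0].
Proof.
move=> A0; split.
- split=> [_ ->//|//|_ _ -> ->|a _ _ ->]; first exact: addr0.
  exact: mulr0.
- by move=> /= /eqP; rewrite oner_eq0.
- by move=> a b _ _ /= /eqP; rewrite mulf_eq0 => /orP[]/eqP; [left|right].
Qed.

(** Rank one makes the value group archimedean: the elements divisible by all
    powers of m form a prime ideal, which would lie strictly between 0 and the
    maximal ideal if it contained p. *)
Lemma rank1_archimedean V m p : rank V 1%N -> zar_max V m -> p != 0 ->
  exists n, zar_set V (m ^+ n / p).
Proof.
move=> [_ rk] Mm p0; apply: contrapT => /forallNP npm.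
have m0 : m != 0.
  by apply/negP => /eqP m0; apply: (npm 1%N); rewrite m0 expr1 mul0r; exact: zar0.
have mn0 n : m ^+ n != 0 by rewrite expf_neq0.
pose Q := [set a | forall n, zar_set V (a / m ^+ n)].
have Qp : Q p by move=> n; have [] := zar_dichotomy V (m ^+ n / p);
  [move/npm | rewrite invf_div].
have QV a : Q a -> zar_set V a by move=> /(_ 0%N); rewrite expr0 divr1.
have Qprime : prime_ideal (zar_set V) Q.
  split; first split.
  - exact: QV.
  - by move=> n; rewrite mul0r; exact: zar0.
  - by move=> a b Qa Qb n; rewrite mulrDl; exact: zarD.
  - by move=> a b Va Qb n; rewrite -mulrA; exact: zarM.
  - by move=> /(_ 1%N); rewrite expr1 mul1r; case: Mm => // /eqP; rewrite (negPf m0).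
  - move=> a b Va Vb Qab; apply: contrapT.
    move=> /not_orP[/existsNP[i nai] /existsNP[j nbj]].
    have := Qab (i + j)%N; rewrite exprD -mulf_div => Vabij.
    case: (@zar_max1 V).
    have a0 : a != 0 by apply: contra_notN nai => /eqP ->; rewrite mul0r; exact: zar0.
    have b0 : b != 0 by apply: contra_notN nbj => /eqP ->; rewrite mul0r; exact: zar0.
    have -> : 1 = a / m ^+ i * (b / m ^+ j) * ((a / m ^+ i)^-1 * (b / m ^+ j)^-1).
      by rewrite -[X in _ * X]invfM divff // !mulf_neq0 ?invr_neq0.
    apply: zar_maxMr => //; apply: zar_maxMr; last exact: zar_max_inv.
    exact/zar_max_sub/zar_max_inv.
pose c i := if i is i'.+1 then if i' is 0%N then Q else zar_max V else [set 0].
suff /rk : prime_chain (zar_set V) 2 c by [].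
split=> [[|[|i]] _|[|[|//]] _].
  - exact: zero_prime_ideal (zar0 V).
  - exact: Qprime.
  - exact: zar_max_prime.
  - split=> [_ ->|]; first by case: Qprime => -[].
    by move=> /(_ p Qp) /= /eqP; rewrite (negPf p0).
  - split=> [a Qa|/(_ m Mm)/(_ 2%N)].
      have Qam := Qa 1%N; rewrite expr1 in Qam.
      by rewrite -[a](divfK m0); exact: zar_maxMr.
    rewrite expr2 invfM mulrA divff // mul1r => Vm.
    by case: Mm => // /eqP; rewrite (negPf m0).
Qed.

(** An element t of W outside V has its inverse in the maximal ideal of V, so
    every p in F is a power of t times an element of V. *)
Lemma rank1_maximal V W : rank V 1%N -> zar_set V `<=` zar_set W ->
  zar_set W = zar_set V \/ zar_set W = setT.
Proof.
move=> rk VW; have [WV|/existsNP[t /not_implyP[Wt nVt]]] :=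
  pselect (zar_set W `<=` zar_set V).
  by left; apply/seteqP.
right; apply/seteqP; split=> // p _.
have [->|p0] := eqVneq p 0; first exact: zar0.
have pV0 : p^-1 != 0 by rewrite invr_eq0.
have [n] := rank1_archimedean rk (zar_max_inv nVt) pV0.
have t0 := zar_notin_neq0 nVt.
rewrite invrK => Vtp.
have -> : p = t ^+ n * (t^-1 ^+ n * p).
  by rewrite mulrA -exprMn divff // expr1n mul1r.
by apply: zarM; [exact: zarX|exact: VW].
Qed.

(** * Geometric sums *)

Definition geom (s : nat) u : F := \sum_(i < s) u ^+ i.

Lemma geomS s u : geom s.+1 u = 1 + u * geom s u.
Proof.
rewrite /geom big_ord_recl expr0 big_distrr; congr (_ + _).
by apply: eq_bigr => i _; rewrite lift0 exprS.
Qed.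

Lemma zar_geom V s u : zar_set V u -> zar_set V (geom s u).
Proof.
move=> Vu; elim: s => [|s IHs]; first by rewrite /geom big_ord0; exact: zar0.
by rewrite geomS; apply: zarD; [exact: zar1|exact: zarM].
Qed.

Lemma geomD s k u : geom (s + k) u = geom s u + u ^+ s * geom k u.
Proof.
elim: s => [|s IHs]; first by rewrite /geom big_ord0 add0r expr0 mul1r.
by rewrite addSn !geomS IHs exprS; ring.
Qed.

Lemma geomV s u : u != 0 -> geom s.+1 u = u ^+ s * geom s.+1 u^-1.
Proof.
move=> u0; elim: s => [|s IHs].
  by rewrite /geom !big_ord1 !expr0 mul1r.
rewrite geomS IHs -[in RHS](addn1 s.+1) geomD /geom big_ord1 expr0 mulr1.
by rewrite -/(geom _ _) mulrDr -exprMn divff // expr1n exprS addrC mulrA.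
Qed.

(** For w in the maximal ideal the sum is 1 modulo that ideal. *)
Lemma zar_geom_max V s w : zar_max V w -> zar_unit V (geom s.+1 w).
Proof.
move=> Mw; rewrite geomS; apply: zar_unitDmax; first exact: zar_unit1.
by apply: zar_maxMl => //; apply/zar_geom/zar_max_sub.
Qed.

(** If some geom d u with d >= 1 is a nonunit, then d itself is a period: geom
    (k d) u is a multiple of geom d u, and geom (k d + 1) u is 1 plus u times it.
    Otherwise every geom s u with s >= 1 is a unit, and N = 1 will do. *)
Lemma geom_unit V u : zar_set V u ->
  exists2 N, (0 < N)%N & forall k, zar_unit V (geom (k * N).+1 u).
Proof.
move=> Vu; have [[d Md]|/forallNP nM] := pselect (exists d, zar_max V (geom d.+1 u)).
  exists d.+1 => // k; rewrite geomS; apply: zar_unitDmax; first exact: zar_unit1.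
  apply: zar_maxMr => //; elim: k => [|k IHk].
    by rewrite mul0n /geom big_ord0; left.
  rewrite mulSn geomD; apply: zar_maxD => //.
  by apply: zar_maxMr => //; exact: zarX.
exists 1%N => // k; apply: zar_maxN_unit; first exact: zar_geom.
exact: nM.
Qed.

(** The multiples of the product of the periods of [geom_unit] serve all the
    valuation rings at once. *)
Lemma geom_unit_finite u (S : set (Zar F)) : finite_set S ->
  exists s, forall V, S V -> zar_set V u -> zar_unit V (geom s.+2 u).
Proof.
move=> /finite_seqP[l ->].
suff [N N0 HN] : exists2 N, (0 < N)%N & forall V, V \in l -> zar_set V u ->
    forall k, zar_unit V (geom (k * N).+1 u).
  (* The number of terms is N + 1 >= 2. *)
  by exists N.-1 => V lV Vu; have := HN V lV Vu 1%N; rewrite mul1n -{1}(prednK N0).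
elim: l => [|V l [N N0 HN]]; first by exists 1%N.
have [[N' N'0 HN']|nVu] := pselect (exists2 N', (0 < N')%N &
    forall k, zar_unit V (geom (k * N').+1 u)); last first.
  exists N => // W; rewrite in_cons => /orP[/eqP -> Wu|]; last exact: HN.
  by case: nVu; exact: geom_unit.
exists (N' * N)%N; first by rewrite muln_gt0 N'0.
move=> W; rewrite in_cons => /orP[/eqP -> _ k|lW Wu k].
  by rewrite (mulnC N') mulnA; exact: HN'.
by rewrite mulnA; exact: HN.
Qed.

End ValuationRing.

(** * Limit points in the patch topology *)

Section PatchLimits.
Variable F : fieldType.
Implicit Types (U V W : Zar F) (S X : set (Zar F)) (t u x : F).

Lemma patch_basic_open xy : patch_index xy -> open (@patch_basic F xy).
Proof.
move=> ixy; exists [set xy] => [_ -> //|].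
by rewrite bigcup_set1.
Qed.

Lemma limit_point_basic S U (xs ys : set F) : limit_point S U ->
  finite_set xs -> finite_set ys -> xs `<=` zar_set U -> ys `<=` ~` zar_set U ->
  exists V, [/\ S V, xs `<=` zar_set V & ys `<=` ~` zar_set V].
Proof.
move=> limU fx fy xU yU.
have nU : nbhs U (patch_basic (xs, ys)).
  by apply: open_nbhs_nbhs; split; [exact: patch_basic_open | split].
by have [V [_ SV [? ?]]] := limU _ nU; exists V.
Qed.

(** The patch topology makes membership of t a clopen condition. Hence it and
    its negation pass to limit points. *)
Lemma limit_point_zar S U t : limit_point S U ->
  (forall V, S V -> zar_set V t) -> zar_set U t.
Proof.
move=> limU St; apply: contrapT => nUt.
have tU : [set t] `<=` ~` zar_set U by move=> _ ->.
have [V [/St Vt _ /(_ t erefl)//]] := limit_point_basic limU (finite_set0 F)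
  (finite_set1 t) (@sub0set _ _) tU.
Qed.

Lemma limit_point_zarN S U t : limit_point S U ->
  (forall V, S V -> ~ zar_set V t) -> ~ zar_set U t.
Proof.
move=> limU St Ut.
have tU : [set t] `<=` zar_set U by move=> _ ->.
have [V [/St nVt /(_ t erefl)//]] := limit_point_basic limU (finite_set1 t)
  (finite_set0 F) tU (@sub0set _ _).
Qed.

Lemma limit_point_sub S X : S `<=` X -> limit_point S `<=` limit_point X.
Proof.
move=> SX U limU B nB; have [V [VU SV BV]] := limU B nB.
by exists V; split=> //; exact: SX.
Qed.

(** Compactness of Zar(F). For an ultrafilter on S containing the cofinite
    subsets of S, the elements t lying in almost all members form a valuation
    ring; each of its basic neighborhoods is in the ultrafilter, and therefore
    still meets S when the point itself is removed. *)
Lemma infinite_limit_point S : infinite_set S -> limit_point S !=set0.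
Proof.
move=> infS.
pose H := [set A : set (Zar F) | finite_set (S `\` A)].
have HP : ProperFilter H.
  split; first by rewrite /H /= setD0.
  split=> [|A B|A B AB].
  - by rewrite /H /= setDT.
  - by rewrite /H /= setDIr finite_setU.
  - by apply: sub_finite_set; exact: setDS.
have [G [UG HG]] := ultraFilterLemma HP.
have FG : ProperFilter G := @ultra_proper _ _ UG.
have GD A : G A \/ G (~` A) by exact: in_ultra_setVsetC.
have GN A B : G A -> G B -> exists V, A V /\ B V.
  by move=> GA GB; exact: (filter_ex (filterI GA GB)).
pose U0 := [set t | G [set V : Zar F | zar_set V t]].
have hU0 : valuation_ring U0.
  split.
    apply/subringP; split=> [|a b Ga Gb|a b Ga Gb]; rewrite /U0 /=.
    - by apply: filterS filterT => V _; exact: zar1.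
    - by apply: filterS (filterI Ga Gb) => V [? ?]; exact: zarB.
    - by apply: filterS (filterI Ga Gb) => V [? ?]; exact: zarM.
  move=> t _; have [|Gt] := GD [set V | zar_set V t]; first by left.
  right; apply: filterS Gt => V /= nVt; exact/zar_max_sub/zar_max_inv.
exists (MkZar hU0) => B.
rewrite nbhsE => -[O [[D' sD' <-] [[xs ys] D'i [/= xU yU]]] OB].
have [fx fy] : patch_index (xs, ys) by exact: sD'.
have Gx : G [set V : Zar F | forall t, xs t -> zar_set V t].
  exact: filter_forall_finite.
have Gy : G [set V : Zar F | forall t, ys t -> ~ zar_set V t].
  pose P t := [set V : Zar F | ~ zar_set V t].
  apply: (filter_forall_finite (P := P)) => // t /yU nGt.
  by have [/nGt|] := GD [set V | zar_set V t].
have GS : G (S `\ MkZar hU0).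
  by apply: HG; rewrite /H /= setDD; apply: finite_setIr; exact: finite_set1.
have [V [[xV yV] [SV /eqP VU]]] := GN _ _ (filterI Gx Gy) GS.
by exists V; split=> //; apply: OB; exists (xs, ys).
Qed.

End PatchLimits.

(** * Intersections of valuation rings *)

Section ZarInter.
Variable F : fieldType.
Implicit Types (Y : set (Zar F)) (V : Zar F).

Lemma zar_inter1 Y : zar_inter Y 1.
Proof. by move=> V _; exact: zar1. Qed.

Lemma zar_inter0 Y : zar_inter Y 0.
Proof. by move=> V _; exact: zar0. Qed.

Lemma zar_interD Y a b : zar_inter Y a -> zar_inter Y b -> zar_inter Y (a + b).
Proof. by move=> Ya Yb V YV; apply: zarD; [exact: Ya|exact: Yb]. Qed.

Lemma zar_interB Y a b : zar_inter Y a -> zar_inter Y b -> zar_inter Y (a - b).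
Proof. by move=> Ya Yb V YV; apply: zarB; [exact: Ya|exact: Yb]. Qed.

Lemma zar_interM Y a b : zar_inter Y a -> zar_inter Y b -> zar_inter Y (a * b).
Proof. by move=> Ya Yb V YV; apply: zarM; [exact: Ya|exact: Yb]. Qed.

Lemma zar_interX Y a n : zar_inter Y a -> zar_inter Y (a ^+ n).
Proof. by move=> Ya V YV; apply: zarX; exact: Ya. Qed.

Lemma zar_inter_subring Y : subring (zar_inter Y).
Proof.
by apply/subringP; split; [exact: zar_inter1|exact: zar_interB|exact: zar_interM].
Qed.

Definition zar_center Y V : set F := zar_inter Y `&` zar_max V.

Lemma zar_center_prime Y V : Y V -> prime_ideal (zar_inter Y) (zar_center Y V).
Proof.
move=> YV; split.
- split=> [a []//||a b [Aa Ma] [Ab Mb]|a b Aa [Ab Mb]].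
  + by split; [exact: zar_inter0|exact: zar_max0].
  + by split; [exact: zar_interD|exact: zar_maxD].
  + by split; [exact: zar_interM|apply: zar_maxMr => //; exact: Aa].
- by case=> _ /zar_max1.
- move=> a b Aa Ab [_] /zar_maxM_prime[||Ma|Mb]; [exact: Aa|exact: Ab|left|right];
  by split.
Qed.

Lemma zar_center_unit Y V a :
  zar_inter Y a -> ~ zar_center Y V a -> Y V -> zar_unit V a.
Proof.
by move=> Aa nMa YV; apply: zar_maxN_unit => [|Ma]; [exact: Aa | apply: nMa].
Qed.

End ZarInter.

(** * Collections with finitely many limit points and a common nonunit *)

Section CompactCollection.
Variables (F : fieldType) (Y E : set (Zar F)) (x : F).
Implicit Types (U V W : Zar F) (S : set (Zar F)).

Hypothesis Y_neq0 : Y !=set0.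
Hypothesis x_inter : zar_inter Y x.
Hypothesis x_max : forall V, Y V -> ~ zar_set V x^-1.
Hypothesis E_fin : finite_set E.
(** Compactness of Y, with all accumulation in E. Only single conditions t in V
    and t not in V are recorded, as the sets to be shown finite are all defined
    by such conditions. *)
Hypothesis E_lim : forall S, infinite_set S -> S `<=` Y ->
  exists U, [/\ E U, Y U, forall t, (forall V, S V -> zar_set V t) -> zar_set U t
    & forall t, (forall V, S V -> ~ zar_set V t) -> ~ zar_set U t].
Hypothesis YE_rank1 : forall W, (Y `\` E) W -> rank W 1%N.
Hypothesis YE_incomp : forall W V, (Y `\` E) W -> Y V -> V <> W ->
  ~ (zar_set V `<=` zar_set W).

Local Notation A := (zar_inter Y).

Lemma x_mem_max V : Y V -> zar_max V x.
Proof. by move=> /x_max; right. Qed.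

Lemma x_neq0 : x != 0.
Proof.
have [V YV] := Y_neq0; apply/negP => /eqP x0.
by apply: (x_max YV); rewrite x0 invr0; exact: zar0.
Qed.

(** Neither ring contains the other, V being no overring of W because W has rank
    one and V <> F. The quotient of an element of V outside W by an element of W
    outside V has the wanted values. *)
Lemma separating_fraction W V : (Y `\` E) W -> Y V -> V <> W ->
  exists t, ~ zar_set W t /\ zar_max V t.
Proof.
move=> YEW YV VW.
have /existsNP[t /not_implyP[Vt nWt]] := YE_incomp YEW YV VW.
have [|WV] := pselect (zar_set W `<=` zar_set V).
  move=> /(rank1_maximal (YE_rank1 YEW))[/zar_inj//|VT].
  by case: (x_max YV); rewrite VT.
have /existsNP[r /not_implyP[Wr nVr]] := WV.
exists (t / r); split; last by apply: zar_maxMr => //; exact: zar_max_inv.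
have r0 := zar_notin_neq0 nVr.
by apply: contra_not nWt => Wtr; rewrite -[t](divfK r0); exact: zarM.
Qed.

(** The element is e = 1 / geom s r with r = x t^n. Where r is a nonunit or not
    a member, e is automatically integral: it is 1 or 0 modulo the maximal ideal.
    So s must only be adapted to the members of Y where r is a unit, and n is
    chosen to make these finite in number. The factor x is what
    keeps r from being a unit on E: if x t^n and x t^k were both units for n > k,
    then so would be t^(n-k), hence t, hence x. *)
Lemma separating_element W t : (Y `\` E) W -> ~ zar_set W t ->
  exists e, [/\ A e, zar_max W e & forall V, Y V -> zar_max V t -> zar_max V (1 - e)].
Proof.
move=> YEW nWt; have YW : Y W by case: YEW.
have [n [nWr rE]] : exists n, ~ zar_set W (x * t ^+ n.+1) /\
    forall U, E U -> Y U -> ~ zar_unit U (x * t ^+ n.+1).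
  have x0 := x_neq0; have xx0 : x ^+ 2 != 0 by rewrite expf_neq0.
  (* Dividing by x^2 rather than x makes the inverse of x t^n a multiple of x
     in W, hence a nonunit. *)
  have [n0 Wn0] := rank1_archimedean (YE_rank1 YEW) (zar_max_inv nWt) xx0.
  (* Beyond the one bad exponent of U, if any, x t^n is not a unit of U. *)
  have [n1 Hn1] : exists n1, forall n, (n1 <= n)%N -> forall U, (E `&` Y) U ->
      ~ zar_unit U (x * t ^+ n.+1).
    apply: eventually_finite; first exact: finite_setIl.
    move=> U [EU YU]; have [[k Uk]|/forallNP nU] :=
      pselect (exists k, zar_unit U (x * t ^+ k.+1)); last by exists 0%N.
    exists k.+1 => n kn Un.
    have Ut : zar_unit U t.
      have tX0 m : x * t ^+ m.+1 != 0 -> t != 0.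
        by rewrite mulf_eq0 negb_or expf_eq0 /= => /andP[_].
      have t0 := tX0 _ (zar_unit_neq0 Un).
      have e : x * t ^+ n.+1 / (x * t ^+ k.+1) = t ^+ (n - k.+1).+1.
        rewrite -mulf_div divff // mul1r.
        have -> : n.+1 = ((n - k.+1).+1 + k.+1)%N by rewrite addSn subnK.
        by rewrite exprD mulfK // expf_neq0.
      by apply: (@zar_unitXV _ _ _ (n - k.+1)); rewrite -e; apply/zar_unitM/zar_unitV.
    apply: (zar_max_unitF (x_mem_max YU)).
    rewrite -[x](mulfK (zar_unit_neq0 (zar_unitX k.+1 Ut))).
    exact/zar_unitM/zar_unitV/zar_unitX.
  exists (maxn n0 n1); split=> [Wr|U EU YU]; last by apply: Hn1; rewrite ?leq_maxr.
  apply: (x_max YW).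
  set N := maxn n0 n1 in Wr *.
  have WN : zar_set W (t^-1 ^+ N.+1 / x ^+ 2).
    have n0N : (n0 <= N.+1)%N by rewrite leqW // leq_maxl.
    rewrite -(subnK n0N) exprD -mulrA; apply: zarM => //.
    by apply/zarX/zar_max_sub/zar_max_inv.
  have -> : x^-1 = x * t ^+ N.+1 * (t^-1 ^+ N.+1 / x ^+ 2).
    have t0 := zar_notin_neq0 nWt.
    rewrite -mulrA (mulrA (t ^+ _)) -exprMn divff // expr1n mul1r.
    by rewrite expr2 invfM mulrA divff // mul1r.
  exact: zarM.
set r := x * t ^+ n.+1 in nWr rE.
have r_neq0 := zar_notin_neq0 nWr.
have [s Hs] : exists s, forall V, Y V -> zar_unit V r -> zar_unit V (geom s.+2 r).
  have [|s Hs] := @geom_unit_finite _ r (Y `&` [set V | zar_unit V r]).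
    apply: contrapT => /E_lim[|U [EU YU UV _]]; first by move=> V [].
    apply: (rE U EU YU); split.
    - exact: r_neq0.
    - by apply: UV => V [_ /zar_unit_sub].
    - by apply: UV => V [_ /zar_unit_inv].
  by exists s => V YV Vr; apply: Hs => //; exact: zar_unit_sub.
have Vg V : Y V -> zar_set V r -> zar_unit V (geom s.+2 r).
  move=> YV /zar_unitVmax[Ur|Mr]; first exact: Hs.
  exact: zar_geom_max.
have nVg V : ~ zar_set V r -> zar_max V (geom s.+2 r)^-1.
  move=> nVr; rewrite geomV // invfM; apply: zar_maxMl.
    by rewrite -exprVn; apply/zar_maxX/zar_max_inv.
  exact/zar_unit_inv/zar_geom_max/zar_max_inv.
exists (geom s.+2 r)^-1; split.
- move=> V YV; have [Vr|nVr] := pselect (zar_set V r).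
    exact/zar_unit_inv/Vg.
  exact/zar_max_sub/nVg.
- exact: nVg.
- move=> V YV Mt.
  have Mr : zar_max V r.
    by apply: zar_maxMr; [apply: x_inter|apply: zar_maxX].
  have Ug := Vg V YV (zar_max_sub Mr).
  have g0 := zar_unit_neq0 Ug.
  have -> : 1 - (geom s.+2 r)^-1 = r * (geom s.+1 r / geom s.+2 r).
    apply: (mulIf g0); rewrite mulrBl mul1r mulVf // -mulrA divfK //.
    by rewrite [in LHS]geomS addrC addKr.
  apply: zar_maxMl => //; apply: zarM; first exact/zar_geom/zar_max_sub.
  exact: zar_unit_inv.
Qed.

(** The product of the elements 1 - e, with e the separating elements of the
    various t, vanishes as soon as one factor does. *)
Lemma separating_product W (l : seq F) : (Y `\` E) W ->
  (forall t, t \in l -> ~ zar_set W t) ->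
  exists z, [/\ A z, zar_max W (1 - z)
    & forall V t, Y V -> t \in l -> zar_max V t -> zar_max V z].
Proof.
move=> YEW; have YW : Y W by case: YEW.
elim: l => [|t l IHl] nWl.
  exists 1; split=> //; first exact: zar_inter1.
  by rewrite subrr; exact: zar_max0.
have [z [Az Wz Mz]] := IHl (fun u lu => nWl u (mem_behead (s := t :: l) lu)).
have [e [Ae We Me]] := separating_element YEW (nWl t (mem_head t l)).
have A1e : A (1 - e) by apply: zar_interB => //; exact: zar_inter1.
exists ((1 - e) * z); split.
- exact: zar_interM.
- have -> : 1 - (1 - e) * z = (1 - z) + e * z by ring.
  by apply: zar_maxD => //; apply: zar_maxMl => //; exact: Az.
- move=> V u YV; rewrite in_cons => /orP[/eqP -> Mt|lu Mu].
    by apply: zar_maxMl; [exact: Me|exact: Az].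
  by apply: zar_maxMr; [exact: A1e|exact: Mz Mu].
Qed.

(** The quasi-compactness argument: for U in E a fraction tau U separates W from
    U, and the same fraction works near U. The set S of the members of Y not
    served by these has no limit point in E, so it is finite, and one fraction
    for each of its members completes the list. *)
Lemma isolating_element W : (Y `\` E) W ->
  exists z, [/\ A z, zar_max W (1 - z) & forall V, Y V -> V <> W -> zar_max V z].
Proof.
move=> YEW; have YW : Y W by case: YEW.
have /choice[tau Htau] : forall V, exists t,
    Y V -> V <> W -> ~ zar_set W t /\ zar_max V t.
  move=> V; have [YV|] := pselect (Y V); last by exists 0.
  have [->|VW] := eqVneq V W; first by exists 0.
  have [t Ht] := separating_fraction YEW YV (elimN eqP VW).
  by exists t.
have tau0 V : Y V -> V <> W -> tau V != 0.
  by move=> YV VW; have [/zar_notin_neq0] := Htau V YV VW.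
pose S := [set V | [/\ Y V, V <> W & forall U, E U -> Y U -> zar_set V (tau U)^-1]].
have Sfin : finite_set S.
  apply: contrapT => /E_lim[V []//|U [EU YU US _]].
  have UW : U <> W by move=> UW; case: YEW => _; rewrite -UW.
  have [_ [/eqP|]] := Htau U YU UW; first by rewrite (negPf (tau0 U YU UW)).
  by apply; apply: US => V [_ _]; exact.
pose S' := (E `&` Y) `|` S.
have /finite_seqP[l el] : finite_set (tau @` S').
  by apply: finite_image; rewrite finite_setU; split=> //; exact: finite_setIl.
have lE t : t \in l -> (tau @` S') t by rewrite el.
have El V : S' V -> tau V \in l.
  by move=> SV; have : (tau @` S') (tau V) by [exists V]; rewrite el.
have SW V : S' V -> Y V /\ V <> W.
  by case=> [[EV YV]|[]//]; split=> // VW; case: YEW => _; rewrite -VW.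
have [t /lE[V /SW[YV VW] <-]|z [Az Wz Mz]] := @separating_product W l YEW.
  by have [] := Htau V YV VW.
exists z; split=> // V YV VW.
have [SV|nSV] := pselect (S V).
  by apply: (Mz V (tau V)) => //; [apply: El; right|have [] := Htau V YV VW].
have [U /not_implyP[EU /not_implyP[YU nVU]]] : exists U,
    ~ (E U -> Y U -> zar_set V (tau U)^-1).
  by apply/existsNP => VU; apply: nSV.
by apply: (Mz V (tau U)) => //; [apply: El; left|right].
Qed.

(** Isolating elements of distinct rings add up without interference, each being
    0 at all the others. *)
Lemma isolating_sum (l : seq (Zar F)) : uniq l ->
  (forall V, V \in l -> (Y `\` E) V) ->
  exists z, A z /\
    forall V, Y V -> if V \in l then zar_max V (1 - z) else zar_max V z.
Proof.
elim: l => [_ _|W l IHl /= /andP[Wl ul] lY].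
  by exists 0; split=> [|V _]; [exact: zar_inter0|exact: zar_max0].
have [z [Az Mz]] := IHl ul (fun u lu => lY u (mem_behead (s := W :: l) lu)).
have YEW := lY W (mem_head W l).
have [z' [Az' Wz' Mz']] := isolating_element YEW.
exists (z' + z); split=> [|V YV]; first exact: zar_interD.
have := Mz V YV; rewrite in_cons; have [->|VW] := eqVneq V W.
  by rewrite (negPf Wl) /= opprD addrA => ?; exact: zar_maxB.
have {}Mz' := Mz' V YV (elimN eqP VW).
rewrite /=; case: ifP => _ Mzv; last exact: zar_maxD.
by rewrite opprD addrCA addrC; apply: zar_maxB.
Qed.

(** Let s be adapted to u and E, and S the set of the members V of Y that contain
    u but where geom s u is not a unit: a limit point of S would be of the same
    kind and in E, so that S is finite and disjoint from E. The sum z of its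
    isolating elements is a unit on S; on the rest of Y it is a nonunit and does
    not disturb geom s u. *)
Lemma nagata_correction u : exists s z, A z /\ forall V, Y V ->
  (zar_set V u -> zar_unit V (geom s.+2 u + z)) /\
  (~ zar_set V u -> zar_unit V ((geom s.+2 u + z) / u ^+ s.+1)).
Proof.
have [s Hs] := geom_unit_finite u E_fin.
pose g := geom s.+2 u.
pose S := [set V | [/\ Y V, zar_set V u & zar_max V g]].
have SE V : S V -> (Y `\` E) V.
  by move=> [YV Vu Mg]; split=> // /Hs/(_ Vu); exact: zar_max_unitF.
have Sfin : finite_set S.
  apply: contrapT => infS; have [V []//|U [EU YU US nUS]] := E_lim infS.
  have Uu : zar_set U u by apply: US => V [].
  have /zar_unit_inv Ug := Hs U EU Uu.
  have g0 := zar_unit_neq0 (Hs U EU Uu).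
  by apply: (nUS _ _ Ug) => V [_ _ [/eqP|//]]; rewrite (negPf g0).
have /finite_seqP[l el] := Sfin.
have lS V : V \in undup l -> S V by rewrite mem_undup el.
have Sl V : S V -> V \in undup l by rewrite mem_undup el.
have [z [Az Mz]] := isolating_sum (undup_uniq l) (fun V lV => SE V (lS V lV)).
exists s, z; split=> // V YV; split=> [Vu|nVu].
  have := Mz V YV; case: ifP => [/lS[_ _ Mg] /zar_max_unit1 Uz|/negP nl Mz'].
    by rewrite addrC; exact: zar_unitDmax.
  apply: zar_unitDmax => //; apply: zar_maxN_unit; first exact: zar_geom.
  by move=> Mg; apply: nl; exact: Sl.
have u0 := zar_notin_neq0 nVu.
rewrite mulrDl geomV // mulrAC divff ?expf_neq0 // mul1r -exprVn.
apply: zar_unitDmax; first exact/zar_geom_max/zar_max_inv.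
by apply: zar_maxMr; [exact: Az|exact/zar_maxX/zar_max_inv].
Qed.

(** With f = geom s u + z of [nagata_correction], p = (1 + z) / f and q = (geom
    (s-1) u) / f. Everything is integral since f is a unit where u is a member and
    otherwise a unit times the top power of u. *)
Lemma invertible_1_u u :
  exists p q, [/\ A p, A q, A (p * u), A (q * u) & p + q * u = 1].
Proof.
have [s [z [Az Hf]]] := nagata_correction u.
set f := geom s.+2 u + z in Hf.
have [V0 YV0] := Y_neq0.
have f0 : f != 0.
  have [Vu nVu] := Hf V0 YV0; have [/Vu/zar_unit_neq0//|/nVu/zar_unit_neq0] :=
    pselect (zar_set V0 u).
  by rewrite mulf_eq0 negb_or => /andP[].
have Auf i : (i <= s.+1)%N -> A (u ^+ i / f).
  move=> si V YV; have [Vf nVf] := Hf V YV.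
  have [Vu|nVu] := pselect (zar_set V u).
    by apply: zarM; [exact: zarX|exact/zar_unit_inv/Vf].
  have u0 := zar_notin_neq0 nVu.
  have -> : u ^+ i / f = u^-1 ^+ (s.+1 - i) * (f / u ^+ s.+1)^-1.
    rewrite invf_div mulrA; congr (_ / _).
    by rewrite -{2}(subnK si) exprD mulrA -exprMn mulVf // expr1n mul1r.
  apply: zarM; first exact/zarX/zar_max_sub/zar_max_inv.
  exact/zar_unit_inv/nVf.
have Agf i k : (i + k <= s.+2)%N -> A (geom k u * u ^+ i / f).
  elim: k i => [|k IHk] i ik.
    by rewrite /geom big_ord0 !mul0r; exact: zar_inter0.
  rewrite geomS mulrDl mul1r mulrDl; apply: zar_interD.
    by apply: Auf; rewrite -ltnS (leq_trans _ ik) // addnS ltnS leq_addr.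
  by rewrite (mulrC u) -(mulrA _ u) -exprS; apply: IHk; rewrite addSnnS.
exists ((1 + z) / f), (geom s.+1 u / f).
have A1z : A (1 + z) by apply: zar_interD => //; exact: zar_inter1.
split.
- by apply: zar_interM => //; rewrite -[f^-1]mul1r -(expr0 u); exact: Auf.
- by have := Agf 0%N s.+1; rewrite expr0 mulr1; apply; rewrite add0n.
- by rewrite -mulrA; apply: zar_interM => //; rewrite mulrC -{1}(expr1 u); exact: Auf.
- by have := Agf 1%N s.+1; rewrite expr1 mulrAC; apply.
- rewrite mulrAC -mulrDl -[RHS](divff f0); congr (_ / _).
  by rewrite /f (geomS s.+1); ring.
Qed.

(** With f for u = a / b as in [nagata_correction], the combination is the
    homogenization b^(s-1) f, a unit multiple of b^(s-1) where u is a member and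
    of a^(s-1) elsewhere. *)
Lemma bezout_units a b : A a -> A b ->
  exists c al be, [/\ A al, A be, c = al * a + be * b
  & forall V, Y V -> zar_unit V a \/ zar_unit V b -> zar_unit V c].
Proof.
move=> Aa Ab; have [b0|b0] := eqVneq b 0.
  exists a, 1, 0; split; [exact: zar_inter1|exact: zar_inter0| |].
    by rewrite mul1r mul0r addr0.
  by move=> V YV [//|[]]; rewrite b0 eqxx.
have [s [z [Az Hf]]] := nagata_correction (a / b).
set u := a / b in Hf; set f := geom s.+2 u + z in Hf.
have ab : a = u * b by rewrite divfK.
have Abg k i : (k <= i.+1)%N -> A (b ^+ i * geom k u).
  elim: k i => [|k IHk] i ki.
    by rewrite /geom big_ord0 mulr0; exact: zar_inter0.
  rewrite geomS mulrDr mulr1; apply: zar_interD; first exact: zar_interX.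
  case: i ki => [|i] ki.
    by case: k ki {IHk} => // _; rewrite /geom big_ord0 !mulr0; exact: zar_inter0.
  have -> : b ^+ i.+1 * (u * geom k u) = a * (b ^+ i * geom k u).
    by rewrite ab exprS; ring.
  by apply: zar_interM => //; exact: IHk.
have cE : b ^+ s.+1 * f = b ^+ s * geom s.+1 u * a + b ^+ s * (1 + z) * b.
  by rewrite /f (geomS s.+1) ab exprS; ring.
exists (b ^+ s.+1 * f), (b ^+ s * geom s.+1 u), (b ^+ s * (1 + z)); split=> //.
- exact: Abg.
- apply: zar_interM; first exact: zar_interX.
  by apply: zar_interD => //; exact: zar_inter1.
- move=> V YV Uab; have [Vf nVf] := Hf V YV.
  have [Ub|Mb] := zar_unitVmax (Ab V YV).
    apply: zar_unitM; first exact: zar_unitX.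
    by apply: Vf; apply: zarM; [exact: Aa|exact: zar_unit_inv].
  have {Uab} Ua : zar_unit V a by case: Uab => // /(zar_max_unitF Mb).
  have nVu : ~ zar_set V u.
    have a0 := zar_unit_neq0 Ua.
    move=> Vu; apply: (zar_max_unitF Mb); split=> //; first exact: Ab.
    have -> : b^-1 = u * a^-1 by rewrite /u mulrAC divff // mul1r.
    by apply: zarM => //; exact: zar_unit_inv.
  have u0 := zar_notin_neq0 nVu.
  have -> : b ^+ s.+1 * f = a ^+ s.+1 * (f / u ^+ s.+1).
    have -> : b ^+ s.+1 = a ^+ s.+1 / u ^+ s.+1.
      by rewrite ab exprMn mulrAC divff ?mul1r // expf_neq0.
    by rewrite mulrAC -mulrA.
  by apply: zar_unitM; [exact: zar_unitX|exact: nVf].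
Qed.

Lemma bezout_units_seq (l : seq F) I : ideal A I -> (forall a, a \in l -> I a) ->
  exists2 c, I c & forall V a, Y V -> a \in l -> zar_unit V a -> zar_unit V c.
Proof.
move=> idI; have [IA I0 ID IM] := idI.
elim: l => [|a l IHl] Il; first by exists 0.
have [c Ic Hc] := IHl (fun u lu => Il u (mem_behead (s := a :: l) lu)).
have Ia := Il a (mem_head a l).
have [d [al [be [Aal Abe -> Hd]]]] := bezout_units (IA _ Ia) (IA _ Ic).
exists (al * a + be * c); first by apply: ID; apply: IM.
move=> V b YV; rewrite in_cons => /orP[/eqP -> Va|lb Vb].
  by apply: Hd => //; left.
by apply: Hd => //; right; exact: Hc Vb.
Qed.

(** Otherwise M would contain, for every V in Y, a unit m V of V, which stays a
    unit near V. By compactness finitely many of them suffice for all of Y, and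
    [bezout_units_seq] makes them into one element of M that is a unit of A(Y). *)
Lemma maximal_ideal_center M : maximal_ideal A M ->
  exists2 W, Y W & M = zar_center Y W.
Proof.
move=> [idM [MA nAM] Mmax]; have [_ M0 _ MM] := idM.
apply: contrapT => nW.
have nM1 : ~ M 1 by move=> M1; apply: nAM => a Aa; rewrite -[a]mulr1; exact: MM.
have /choice[m Hm] : forall V, exists a, M a /\ (Y V -> zar_unit V a).
  move=> V; have [YV|] := pselect (Y V); last by exists 0.
  apply: contrapT => /forallNP nV; apply: nW; exists V => //.
  have [idC nC1 _] := zar_center_prime YV.
  apply/esym/Mmax => //.
    move=> a Ma; apply: contrapT => nCa; apply: (nV a); split=> // _.
    by apply: zar_center_unit YV => //; exact: MA.
  split; first by case: idC.
  by move=> sAC; apply/nC1/sAC/zar_inter1.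
pose S := [set V | Y V /\ forall U, E U -> Y U -> ~ zar_set V (m U)^-1].
have Sfin : finite_set S.
  apply: contrapT => /E_lim[V []//|U [EU YU _ US]].
  have [_ /(_ YU)/zar_unit_inv] := Hm U.
  by apply: US => V [_]; exact.
have /finite_seqP[l el] : finite_set (m @` ((E `&` Y) `|` S)).
  by apply: finite_image; rewrite finite_setU; split=> //; exact: finite_setIl.
have lE t : t \in l -> (m @` ((E `&` Y) `|` S)) t by rewrite el.
have El V : ((E `&` Y) `|` S) V -> m V \in l.
  by move=> SV; have : (m @` ((E `&` Y) `|` S)) (m V) by [exists V]; rewrite el.
have [a /lE[V _ <-]|c Mc Hc] := @bezout_units_seq l M idM; first by case: (Hm V).
have Vc V : Y V -> zar_unit V c.
  move=> YV; have [SV|nSV] := pselect (S V).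
    by apply: (Hc V (m V)) => //; [apply: El; right|exact: (Hm V).2].
  have [U /not_implyP[EU /not_implyP[YU /contrapT Vm]]] : exists U,
      ~ (E U -> Y U -> ~ zar_set V (m U)^-1).
    by apply/existsNP => VU; apply: nSV.
  apply: (Hc V (m U)) => //; first by apply: El; left.
  split=> //; first exact: (zar_unit_neq0 ((Hm U).2 YU)).
  exact: (MA _ (Hm U).1).
have [V0 YV0] := Y_neq0.
apply: nM1; rewrite -(mulVf (zar_unit_neq0 (Vc V0 YV0))).
by apply: MM => // V YV; exact: zar_unit_inv (Vc V YV).
Qed.

(** Given p + q a = 1 as in [invertible_1_u], a is (p a) / p or (q a) / q; if p
    is in the center, then q a is a unit of W, and so is q since a is in W. *)
Lemma sub_localization_center W a : Y W -> zar_set W a ->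
  localization A (zar_center Y W) a.
Proof.
move=> YW Wa; have [p [q [Ap Aq Apa Aqa pq]]] := invertible_1_u a.
have [Mp|nMp] := pselect (zar_max W p); last first.
  have p0 : p != 0 by apply: contra_notN nMp => /eqP ->; exact: zar_max0.
  exists (p * a) => //; exists p; first by split=> // -[].
  by rewrite mulrAC divff // mul1r.
have Uqa : zar_unit W (q * a).
  by apply: zar_max_unit1; rewrite -pq addrK.
have nMq : ~ zar_max W q.
  by move=> Mq; apply: (zar_max_unitF _ Uqa); exact: zar_maxMl.
exists (q * a) => //; exists q; first by split=> // -[].
have q0 : q != 0 by apply: contra_notN nMq => /eqP ->; exact: zar_max0.
by rewrite mulrAC divff // mul1r.
Qed.

Lemma localization_center W : Y W ->
  localization A (zar_center Y W) = zar_set W.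
Proof.
move=> YW; apply/seteqP; split=> [_ [a Aa [b [Ab nb] <-]]|a]; last first.
  exact: sub_localization_center.
apply: zarM; first exact: Aa.
exact/zar_unit_inv/zar_center_unit/YW.
Qed.

Lemma prufer_inter : prufer_domain A.
Proof.
split; first exact: zar_inter_subring.
move=> M /maximal_ideal_center[W YW ->]; rewrite localization_center //.
by case: (zar_valuation W) => Wr Wd; split=> // t _; exact: Wd.
Qed.

Lemma jacobson_mem : jacobson A x.
Proof.
split=> // M /maximal_ideal_center[W YW ->]; split=> //; exact: x_mem_max.
Qed.

(** Let p <> 0 be in a prime ideal P inside the center and m in the center. By
    rank one some m^k / p is in W, that is, equal to a / b with b outside the
    center; then b m^k is in P, and so is m. So P is the center. *)
Lemma height1_center W : (Y `\` E) W -> ideal_height A (zar_center Y W) 1.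
Proof.
move=> YEW; have YW : Y W by case: YEW.
have Mx : zar_center Y W x by split=> //; exact: x_mem_max.
have x0 := x_neq0.
split.
  exists (fun i => if i is 0%N then [set 0] else zar_center Y W); split=> //.
  split=> [[_|i _]|[_|//]].
  - exact: zero_prime_ideal (@zar_inter0 _ Y).
  - exact: zar_center_prime.
  - split=> [_ ->|/(_ x Mx)/= /eqP]; last by rewrite (negPf x0).
    by split; [exact: zar_inter0|exact: zar_max0].
move=> [//|[//|n]] c [cp cl] cM; exfalso.
have [[PA P0 _ PM] _ Pprime] := cp n.+1 (leqnSn _).
have [[_ Q0 _ _] _ _] := cp n (ltnW (leqnSn _)).
have [QP nPQ] := cl n (leqnSn _).
have [] := cl n.+1 (leqnn _); rewrite cM => PC [] m [Am Mm].
have [p [Pp p0]] : exists p, c n.+1 p /\ p != 0.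
  apply: contrapT => /forallNP np; apply: nPQ => p Pp.
  have [->//|p0] := eqVneq p 0.
  by case: (np p).
have [k Wk] := rank1_archimedean (YE_rank1 YEW) Mm p0.
have [a Aa [b [Ab nCb] e]] := sub_localization_center YW Wk.
have b0 : b != 0.
  by apply: contra_notN nCb => /eqP ->; split; [exact: zar_inter0|exact: zar_max0].
have Pbm : c n.+1 (b * m ^+ k).
  have -> : b * m ^+ k = a * p.
    by rewrite -[m ^+ k](divfK p0) -e mulrA mulrCA divff // mulr1.
  exact: PM.
have [/PC//|] := Pprime b (m ^+ k) Ab (zar_interX k Am) Pbm.
elim: k {e Wk Pbm} => [P1|k IHk]; first by rewrite -[m]mulr1; exact: PM.
by rewrite exprS => /(Pprime _ _ Am (zar_interX k Am))[].
Qed.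

(** An element y <> 0 of the center which is a unit of every other member of Y
    generates an ideal with this radical: for t in the center, some t^k / y is in
    W by rank one, and it is in the other members anyway. *)
Lemma radical_fg_center W : (Y `\` E) W ->
  exists2 I, fg_ideal A I & zar_center Y W = radical A I.
Proof.
move=> YEW; have YW : Y W by case: YEW.
have x0 := x_neq0.
have [y [y0 Cy Uy]] : exists y, [/\ y != 0, zar_center Y W y &
    forall V, Y V -> V <> W -> zar_unit V y].
  have [z [Az Wz Mz]] := isolating_element YEW.
  (* If 1 - z = 0, then W is the only member of Y, as z = 1 is a nonunit of
     every other; so x will do. *)
  have [z1|z1] := eqVneq (1 - z) 0.
    exists x; split=> //; first by split=> //; exact: x_mem_max.
    move=> V YV /(Mz V YV); move/eqP: z1; rewrite subr_eq0 => /eqP <-.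
    by move/zar_max1.
  exists (1 - z); split=> //.
    by split=> //; apply: zar_interB => //; exact: zar_inter1.
  move=> V YV VW; apply: zar_max_unit1.
  by rewrite opprB addrC subrK; exact: Mz.
exists (smallest (ideal A) [set y]).
  by exists [set y]; split=> // _ ->; case: Cy.
have [idC _ Cprime] := zar_center_prime YW.
apply/seteqP; split=> t.
  move=> [At Mt]; split=> //.
  have [k Wk] := rank1_archimedean (YE_rank1 YEW) Mt y0.
  have Atk : A (t ^+ k.+1 / y).
    move=> V YV; have [->|VW] := eqVneq V W.
      by rewrite exprS -mulrA; apply: zarM => //; exact: zar_max_sub.
    apply: zarM; first by apply/zarX/At.
    exact/zar_unit_inv/Uy/eqP.
  exists k => I [[_ _ _ IM] yI].
  by rewrite -[t ^+ _](divfK y0); apply: IM => //; exact: yI.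
move=> [At [k Ik]].
have : zar_center Y W (t ^+ k.+1) by apply: Ik; split=> // _ ->.
by move=> [_ /zar_maxX_prime Mt]; split=> //; apply: Mt; exact: At.
Qed.

Lemma prufer_type_inter : prufer_type A.
Proof.
split; first exact: prufer_inter.
  by exists x; [exact: jacobson_mem|exact: x_neq0].
apply: sub_finite_set (finite_image (zar_center Y) E_fin).
move=> M [/maximal_ideal_center[W YW ->] nW]; exists W => //.
apply: contrapT => nEW; apply: nW.
by split; [apply: height1_center|apply: radical_fg_center].
Qed.

End CompactCollection.

(** * Overrings of the exceptional valuation rings *)

Section OverringClosure.
Variables (F : fieldType) (Y E0 : set (Zar F)).
Implicit Types U V : Zar F.
Hypothesis E0_fin : finite_set E0.
Hypothesis Y_rank1 : forall V, (Y `\` E0) V -> rank V 1%N.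
Hypothesis Y_nontrivial : forall V, Y V -> exists t, ~ zar_set V t.

(** A member of Y outside E0 may contain a member of E0, and then its center on
    A(Y) need not be maximal. Such overrings have to be counted among the
    exceptions. *)
Definition with_overrings :=
  E0 `|` [set V | (Y `\` E0) V /\ exists2 U, E0 U & zar_set U `<=` zar_set V].

(** The overrings of one U are totally ordered and rank one rings are maximal
    proper overrings: so each U in E0 has at most one. *)
Lemma with_overrings_finite : finite_set with_overrings.
Proof.
rewrite finite_setU; split=> //.
rewrite (_ : [set V | _] =
  \bigcup_(U in E0) [set V | (Y `\` E0) V /\ zar_set U `<=` zar_set V]); last first.
  apply/seteqP; split=> V; first by move=> [? [U ? ?]]; exists U.
  by move=> [U ? [? ?]]; split=> //; exists U.
apply: bigcup_finite => // U _; apply: subsingleton_finite => V V' [YV UV] [YV' UV'].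
have max1 W W' : (Y `\` E0) W -> (Y `\` E0) W' ->
    zar_set W `<=` zar_set W' -> W' = W.
  move=> YW [YW' _] /(rank1_maximal (Y_rank1 YW))[/zar_inj//|WT].
  by have [t []] := Y_nontrivial YW'; rewrite WT.
by case: (zar_overring_total UV UV') => [/(max1 _ _ YV YV')|/(max1 _ _ YV' YV)].
Qed.

Lemma with_overrings_incomp V W : (Y `\` with_overrings) W -> Y V -> V <> W ->
  ~ (zar_set V `<=` zar_set W).
Proof.
move=> [YW nEW] YV VW sVW.
have nE0W : ~ E0 W by move=> ?; apply: nEW; left.
have [E0V|nE0V] := pselect (E0 V).
  by apply: nEW; right; split=> //; exists V.
have [|/esym/zar_inj//|WT] := rank1_maximal (Y_rank1 _) sVW; first by split.
by have [t []] := Y_nontrivial YW; rewrite WT.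
Qed.

End OverringClosure.

(** * Splitting the collection *)

Section Decomposition.
Variables (F : fieldType) (X : set (Zar F)).
Implicit Types (U V W : Zar F) (S : set (Zar F)).
Hypothesis X_frac : fractions (zar_inter X) = setT.

Lemma fractions_sub (A B : set F) :
  A `<=` B -> fractions A = setT -> fractions B = setT.
Proof.
move=> AB fA; apply/seteqP; split=> // t _.
have [a Aa [b [Ab b0] <-]] : fractions A t by rewrite fA.
by exists a; [exact: AB|exists b => //; split=> //; exact: AB].
Qed.

Lemma limit_point_inter U : limit_point X U -> zar_inter X `<=` zar_set U.
Proof. by move=> limU a Aa; apply: limit_point_zar limU _ => V XV; exact: Aa. Qed.

(** An element t outside U has its inverse in the maximal ideal of U; a
    numerator of that inverse over A(X) is in the maximal ideal as well. *)
Lemma center_neq0 U : zar_inter X `<=` zar_set U -> (exists t, ~ zar_set U t) ->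
  exists a, [/\ zar_inter X a, a != 0 & ~ zar_set U a^-1].
Proof.
move=> AU [t nUt].
have [a Aa [b [Ab /eqP b0] e]] : fractions (zar_inter X) t^-1 by rewrite X_frac.
have t0 := zar_notin_neq0 nUt.
have a0 : a != 0.
  by apply: contra_neq t0 => a0; apply: invr_inj; rewrite -e a0 mul0r invr0.
exists a; split=> //; apply: contra_not nUt => Ua.
have -> : t = b * a^-1 by rewrite -[t]invrK -e invf_div.
by apply: zarM => //; exact: AU.
Qed.

(** For each U in L the factor belonging to U is a nonunit of U, and a product
    is a nonunit as soon as one factor is. *)
Lemma common_center (L : set (Zar F)) : finite_set L ->
  (forall U, L U -> zar_inter X `<=` zar_set U /\ exists t, ~ zar_set U t) ->
  exists x, [/\ zar_inter X x, x != 0 & forall U, L U -> ~ zar_set U x^-1].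
Proof.
move=> /finite_seqP[l ->]; elim: l => [_|U l IHl HU].
  by exists 1; split=> //; [exact: zar_inter1|exact: oner_neq0].
have [x [Ax x0 xl]] := IHl (fun V lV => HU V (mem_behead (s := U :: l) lV)).
have [AU nU] := HU U (mem_head U l).
have [a [Aa a0 nUa]] := center_neq0 AU nU.
exists (a * x); split; [exact: zar_interM|by rewrite mulf_neq0|].
move=> V lV Vax; have AV : zar_inter X `<=` zar_set V by case: (HU V lV).
move: lV; rewrite /= in_cons => /orP[/eqP VU|/xl]; last first.
  apply; have -> : x^-1 = a * (a * x)^-1 by rewrite invfM mulVKf.
  by apply: zarM => //; exact: AV.
apply: nUa; rewrite -VU.
have -> : a^-1 = x * (a * x)^-1 by rewrite (mulrC a) invfM mulVKf.
by apply: zarM => //; exact: AV.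
Qed.

(** The members of S where y, or the inverse of y, is missing would, if infinite
    in number, have a limit point where it is missing too; but F misses
    nothing. *)
Lemma finite_character_trivial_limit S :
  (forall U, limit_point S U -> zar_set U = setT) -> finite_character S.
Proof.
move=> ST y y0.
have fin1 (y' : F) : finite_set (S `&` [set V | ~ zar_set V y']).
  apply: contrapT => /infinite_limit_point[U limU].
  have UT : zar_set U = setT by apply: ST; apply: limit_point_sub limU; exact: subIsetl.
  have : ~ zar_set U y' by apply: limit_point_zarN limU _ => V [].
  by rewrite UT; apply.
apply: (@sub_finite_set _ _ ((S `&` [set V | ~ zar_set V y]) `|`
  (S `&` [set V | ~ zar_set V y^-1]))).
  by move=> V [SV /not_andP[]]; [left|right].
by rewrite finite_setU.
Qed.

End Decomposition.

Theorem corollary5p4 (F : fieldType) (X : set (Zar F))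
  (X_proper : zar_inter X `<` setT)
  (X_frac : fractions (zar_inter X) = setT)
  (X_lim : finite_set (limit_point X))
  (X_rank : finite_set (X `&` [set V | ~ rank V 1%N])) :
  [\/ finite_real_character (zar_inter X),
      prufer_type (zar_inter X)
    | exists B C : set F,
        [/\ finite_real_character B,
            prufer_type C,
            fractions B = setT,
            fractions C = setT
          & zar_inter X = B `&` C]].
Proof.
pose L := (limit_point X `|` (X `&` [set V | ~ rank V 1%N])) `&`
  [set U | exists t, ~ zar_set U t].
have [|U [[limU|[XU _]] tU]|x [Ax x0 xL]] := @common_center F X X_frac L.
- by apply: finite_setIl; rewrite finite_setU.
- by split=> //; exact: limit_point_inter.
- by split=> // a; apply.
(* The two sides of the splitting: x is a nonunit on Y and a unit on XB. *)
pose Y := (X `|` limit_point X) `&` [set V | ~ zar_set V x^-1].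
pose XB := X `&` [set V | rank V 1%N /\ zar_set V x^-1].
have AY : zar_inter X `<=` zar_inter Y.
  move=> a Aa V [[XV|limV] _]; [exact: Aa|exact: limit_point_inter limV _ Aa].
have AXB : zar_inter X `<=` zar_inter XB by move=> a Aa V [XV _]; exact: Aa.
have AYB : zar_inter XB `&` zar_inter Y `<=` zar_inter X.
  move=> a [Ba Ca] V XV; have [Vx|nVx] := pselect (zar_set V x^-1); last first.
    by apply: Ca; split=> //; left.
  (* Members of X not of rank one on which x is a unit equal F, by the choice
     of x. *)
  have [rk|nrk] := pselect (rank V 1%N); first exact: Ba.
  apply: contrapT => nVa; apply: (xL V) => //.
  by split; [right|exists a].
have Bfin : XB !=set0 -> finite_real_character (zar_inter XB).
  move=> XB0; split; first exact: fractions_sub AXB X_frac.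
  exists XB; split=> // [|V [_ []]//].
  apply: finite_character_trivial_limit => U limU.
  apply: contrapT => /eqP UT; apply: (xL U).
    split; first by left; apply: limit_point_sub limU; exact: subIsetl.
    apply: contrapT => /forallNP Ut; move/eqP: UT; apply.
    by apply/seteqP; split=> // t _; exact: contrapT.
  by apply: limit_point_zar limU _ => V [_ []].
have Cpru : Y !=set0 -> prufer_type (zar_inter Y).
  move=> Y0.
  pose E0 := Y `&` (limit_point X `|` [set V | ~ rank V 1%N]).
  have E0fin : finite_set E0.
    apply: (@sub_finite_set _ _ (limit_point X `|` (X `&` [set V | ~ rank V 1%N]))).
      by move=> V [[[XV|limV] _] [limV'|nrk]]; [left|right|left|left].
    by rewrite finite_setU.
  have Yrk V : (Y `\` E0) V -> rank V 1%N.
    by move=> [YV nE0]; apply: contrapT => nrk; apply: nE0; split=> //; right.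
  have Ynt V : Y V -> exists t, ~ zar_set V t by move=> [_ nVx]; exists x^-1.
  apply: (@prufer_type_inter F Y (with_overrings Y E0) x) => //.
  - exact: AY.
  - by move=> V [].
  - exact: with_overrings_finite.
  - move=> S infS SY.
    have infSX : infinite_set (S `&` X).
      apply: contra_not infS => finSX.
      apply: (@sub_finite_set _ _ ((S `&` X) `|` limit_point X)).
        by move=> V SV; have [[XV|limV] _] := SY V SV; [left|right].
      by rewrite finite_setU.
    have [U limU] := infinite_limit_point infSX.
    have limXU : limit_point X U by apply: limit_point_sub limU; exact: subIsetr.
    have YU : Y U.
      by split; [right|apply: limit_point_zarN limU _ => V [/SY[]]].
    exists U; split=> //.
    + by left; split=> //; left.
    + by move=> t St; apply: limit_point_zar limU _ => V [SV _]; exact: St.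
    + by move=> t St; apply: limit_point_zarN limU _ => V [SV _]; exact: St.
  - by move=> W [YW nEW]; apply: Yrk; split=> // E0W; apply: nEW; left.
  - by move=> W V YEW; apply: with_overrings_incomp YEW.
have AE : zar_inter X = zar_inter XB `&` zar_inter Y.
  by apply/seteqP; split=> // a Aa; split; [exact: AXB|exact: AY].
have inter0 (Z : set (Zar F)) : ~ (Z !=set0) -> zar_inter Z = setT.
  by move=> nZ; apply/seteqP; split=> // a _ V ZV; case: nZ; exists V.
have [XB0|nXB] := pselect (XB !=set0); have [Y0|nY] := pselect (Y !=set0).
- apply: Or33; exists (zar_inter XB), (zar_inter Y); split=> //.
  + exact: Bfin.
  + exact: Cpru.
  + exact: fractions_sub AXB X_frac.
  + exact: fractions_sub AY X_frac.
- by apply: Or31; rewrite AE (inter0 Y) // setIT; exact: Bfin.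
- by apply: Or32; rewrite AE (inter0 XB) // setTI; exact: Cpru.
- by case: X_proper => _; case; rewrite AE !inter0 // setIT.
Qed.
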